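(* Let $G$ be an infinite finitely generated word hyperbolic group which does not have a finite index subgroup isomorphic to $\mathbb{Z}$, and let $S$ be a finite generating set of $G$. If $(G,d_S)$ admits a bilipschitz embedding into a Banach space $X$, then $X$ is nonsuperreflexive.
   Context: A Banach space is superreflexive if it admits an equivalent uniformly convex norm; otherwise it is nonsuperreflexive. $d_S$ denotes the word metric (shortest path metric of the Cayley graph with respect to $S$). Word hyperbolic is in the sense of Gromov. A bilipschitz embedding is a map $f$ with $c\,d(u,v)\le \|f(u)-f(v)\|\le C\,d(u,v)$ for some constants $0<c\le C<\infty$. *)

(* Defs.v *)
From Stdlib Require Import Reals Lra List ZArith ClassicalEpsilon.
Open Scope R_scope.

Record Group := {
  gcar :> Type;
  gmul : gcar -> gcar -> gcar;
  ginv : gcar -> gcar;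
  gone : gcar;
  gmul_assoc : forall a b c, gmul a (gmul b c) = gmul (gmul a b) c;
  gmul_1l : forall a, gmul gone a = a;
  gmul_Vl : forall a, gmul (ginv a) a = gone
}.

Arguments gmul {g}.
Arguments ginv {g}.
Arguments gone {g}.

Definition infinite_group (G : Group) : Prop :=
  ~ exists l : list G, forall g : G, In g l.

Definition letter_val {G : Group} (l : bool * G) : G :=
  if fst l then snd l else ginv (snd l).

Definition word_eval {G : Group} (w : list (bool * G)) : G :=
  fold_right (fun l acc => gmul (letter_val l) acc) gone w.

Definition word_over {G : Group} (S : list G) (w : list (bool * G)) : Prop :=
  forall l, In l w -> In (snd l) S.

Definition generates {G : Group} (S : list G) : Prop :=
  forall g : G, exists w, word_over S w /\ word_eval w = g.

Definition is_word_length {G : Group} (S : list G) (g : G) (n : nat) : Prop :=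
  (exists w, word_over S w /\ word_eval w = g /\ length w = n) /\
  (forall w, word_over S w -> word_eval w = g -> (n <= length w)%nat).

Definition word_length {G : Group} (S : list G) (g : G) : nat :=
  epsilon (inhabits 0%nat) (fun n => is_word_length S g n).

Definition word_dist {G : Group} (S : list G) (u v : G) : R :=
  INR (word_length S (gmul (ginv u) v)).

Definition gromov_prod {G : Group} (S : list G) (x y w : G) : R :=
  (word_dist S x w + word_dist S y w - word_dist S x y) / 2.

Definition word_hyperbolic {G : Group} (S : list G) : Prop :=
  exists delta : R, 0 <= delta /\
    forall x y z w : G,
      gromov_prod S x z w >=
        Rmin (gromov_prod S x y w) (gromov_prod S y z w) - delta.

Definition is_subgroup {G : Group} (H : G -> Prop) : Prop :=
  H gone /\ (forall a b, H a -> H b -> H (gmul a b)) /\ (forall a, H a -> H (ginv a)).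

Definition finite_index {G : Group} (H : G -> Prop) : Prop :=
  exists reps : list G, forall g : G, exists r h, In r reps /\ H h /\ g = gmul r h.

Definition iso_to_Z {G : Group} (H : G -> Prop) : Prop :=
  exists phi : Z -> G,
    (forall m n, phi (m + n)%Z = gmul (phi m) (phi n)) /\
    (forall m n, phi m = phi n -> m = n) /\
    (forall n, H (phi n)) /\
    (forall h, H h -> exists n, phi n = h).

Definition virtually_Z (G : Group) : Prop :=
  exists H : G -> Prop, is_subgroup H /\ finite_index H /\ iso_to_Z H.

Record NormedSpace := {
  vcar :> Type;
  vadd : vcar -> vcar -> vcar;
  vzero : vcar;
  vopp : vcar -> vcar;
  vscal : R -> vcar -> vcar;
  vnorm : vcar -> R;
  vadd_assoc : forall x y z, vadd x (vadd y z) = vadd (vadd x y) z;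
  vadd_comm : forall x y, vadd x y = vadd y x;
  vadd_0l : forall x, vadd vzero x = x;
  vadd_oppr : forall x, vadd x (vopp x) = vzero;
  vscal_assoc : forall a b x, vscal a (vscal b x) = vscal (a * b) x;
  vscal_1 : forall x, vscal 1 x = x;
  vscal_addr : forall a x y, vscal a (vadd x y) = vadd (vscal a x) (vscal a y);
  vscal_addl : forall a b x, vscal (a + b) x = vadd (vscal a x) (vscal b x);
  vnorm_eq0 : forall x, vnorm x = 0 -> x = vzero;
  vnorm_scal : forall a x, vnorm (vscal a x) = Rabs a * vnorm x;
  vnorm_triangle : forall x y, vnorm (vadd x y) <= vnorm x + vnorm y
}.

Arguments vadd {n}.
Arguments vzero {n}.
Arguments vopp {n}.
Arguments vscal {n}.
Arguments vnorm {n}.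

Definition vsub {X : NormedSpace} (x y : X) : X := vadd x (vopp y).

Definition complete (X : NormedSpace) : Prop :=
  forall u : nat -> X,
    (forall eps, eps > 0 -> exists N, forall m n, (m >= N)%nat -> (n >= N)%nat ->
        vnorm (vsub (u m) (u n)) < eps) ->
    exists l : X, forall eps, eps > 0 -> exists N, forall n, (n >= N)%nat ->
        vnorm (vsub (u n) l) < eps.

Definition Banach (X : NormedSpace) : Prop := complete X.

Definition equivalent_norm (X : NormedSpace) (N : X -> R) : Prop :=
  (forall x, N x = 0 -> x = vzero) /\
  (forall a x, N (vscal a x) = Rabs a * N x) /\
  (forall x y, N (vadd x y) <= N x + N y) /\
  exists a b, 0 < a /\ 0 < b /\ forall x, a * vnorm x <= N x /\ N x <= b * vnorm x.

Definition uniformly_convex (X : NormedSpace) (N : X -> R) : Prop :=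
  forall eps, 0 < eps <= 2 -> exists delta, 0 < delta /\
    forall x y : X, N x <= 1 -> N y <= 1 -> N (vsub x y) >= eps ->
      N (vscal (/2) (vadd x y)) <= 1 - delta.

Definition superreflexive (X : NormedSpace) : Prop :=
  exists N : X -> R, equivalent_norm X N /\ uniformly_convex X N.

Definition bilipschitz_embeds {G : Group} (S : list G) (X : NormedSpace) : Prop :=
  exists (f : G -> X) (c C : R), 0 < c /\ c <= C /\
    forall u v : G,
      c * word_dist S u v <= vnorm (vsub (f u) (f v)) /\
      vnorm (vsub (f u) (f v)) <= C * word_dist S u v.

(* Main.v *)
Require Import Defs.
From Stdlib Require Import Reals List Lra Lia ZArith ClassicalEpsilon.
Import ListNotations.

(** If there is a constant [K] such that [G] contains, for every [D], three
    elements of length at least [D] whose pairwise Gromov products at [1] are at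
    most [K], then after any segment at least two of these elements can be
    appended with a small Gromov product at the corner.  Broken geodesics with
    long segments and small corners are quasigeodesics, so this yields a
    bilipschitz binary tree in [G].  In a uniformly convex norm each fork of the
    tree has a branch along which the Lipschitz constant drops by a definite
    factor (Kloeckner's form of Bourgain's theorem), and following such branches
    iteratively contradicts the lower bound.

    If there is no such [K], take [x] and [y] pointing in opposite directions.
    One of [x], [y], [x y^-1] is a long element [h] with
    small [(h | h^-1)], hence of infinite order.  An element that moves away from
    [1] under both [h] and [h^-1] would form, with [h^m] and [h^-m], a triple as
    above, so it is short; thus [<h>] has finite index and [G] is virtually
    cyclic. *)

(** * Trees in uniformly convex spaces *)

Section NormedAlgebra.
Context {X : NormedSpace}.
Implicit Types x y z : X.

Lemma vadd_0r x : vadd x vzero = x.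
Proof. now rewrite vadd_comm, vadd_0l. Qed.

Lemma vadd_cancel_l x y z : vadd x y = vadd x z -> y = z.
Proof.
intros H. rewrite <- (vadd_0l _ y), <- (vadd_0l _ z), <- (vadd_oppr _ x).
rewrite (vadd_comm _ x (vopp x)), <- !vadd_assoc. now rewrite H.
Qed.

Lemma vscal_0l x : vscal 0 x = vzero.
Proof.
apply (vadd_cancel_l (vscal 0 x)).
rewrite <- vscal_addl, vadd_0r. now rewrite Rplus_0_l.
Qed.

Lemma vopp_scal x : vopp x = vscal (-1) x.
Proof.
apply (vadd_cancel_l x). rewrite vadd_oppr.
rewrite <- (vscal_1 _ x) at 1. rewrite <- vscal_addl.
replace (1 + -1) with 0 by ring. now rewrite vscal_0l.
Qed.

Lemma vsub_chain x y z : vadd (vsub x y) (vsub y z) = vsub x z.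
Proof.
unfold vsub. rewrite <- vadd_assoc, (vadd_assoc _ (vopp y) y).
now rewrite (vadd_comm _ (vopp y) y), vadd_oppr, vadd_0l.
Qed.

Lemma vscal_sub a x y : vscal a (vsub x y) = vsub (vscal a x) (vscal a y).
Proof.
unfold vsub. rewrite vscal_addr, !vopp_scal, !vscal_assoc.
now rewrite (Rmult_comm a).
Qed.

Lemma vopp_sub x y : vopp (vsub x y) = vsub y x.
Proof.
apply (vadd_cancel_l (vsub x y)).
now rewrite vadd_oppr, vsub_chain; unfold vsub; rewrite vadd_oppr.
Qed.

Lemma vsub_sub_common x y z : vsub (vsub x z) (vsub y z) = vsub x y.
Proof.
unfold vsub at 1. rewrite vopp_sub. apply vsub_chain.
Qed.

End NormedAlgebra.

Section TreesInNormedSpaces.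
Context {X : NormedSpace} (N : X -> R).
Context (N_scal : forall a x, N (vscal a x) = Rabs a * N x).
Context (N_triangle : forall x y, N (vadd x y) <= N x + N y).

Lemma N_sub_sym x y : N (vsub x y) = N (vsub y x).
Proof.
rewrite <- vopp_sub, vopp_scal, N_scal.
replace (Rabs (-1)) with 1; [ring|].
rewrite Rabs_left; lra.
Qed.

Lemma N_sub_triangle x y z : N (vsub x z) <= N (vsub x y) + N (vsub y z).
Proof. rewrite <- (vsub_chain x y z). apply N_triangle. Qed.

(* Nodes of the binary tree are the lists over [bool]; the children of [w] are
   [true :: w] and [false :: w]. *)
Definition tree_bounds (c C : R) (F : list bool -> X) : Prop :=
  (forall w b, N (vsub (F (b :: w)) (F w)) <= C) /\
  (forall w u u', length u = length u' ->
     c * (INR (length u) + 1) <= N (vsub (F (u ++ true :: w)) (F (u' ++ false :: w)))).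

(** The two children of the root are at least [c] apart and within [C] of the root. *)
Lemma tree_bounds_le c C F : tree_bounds c C F -> c <= 2 * C.
Proof.
intros [HC Hc].
pose proof (Hc [] [] [] eq_refl) as H; simpl in H.
pose proof (N_sub_triangle (F [true]) (F []) (F [false])) as T.
rewrite (N_sub_sym (F [])) in T.
pose proof (HC [] true); pose proof (HC [] false). lra.
Qed.

Context (N_uc : uniformly_convex X N).

(** The contrapositive of uniform convexity, applied to the vectors divided by [r]. *)
Lemma uniformly_convex_scaled eps : 0 < eps <= 2 ->
  exists delta, 0 < delta < 1 /\
    forall r x y, 0 < r -> N x <= r -> N y <= r ->
      2 * (r * (1 - delta)) < N (vadd x y) -> N (vsub x y) < eps * r.
Proof.
intros Heps. destruct (N_uc eps Heps) as [d [Hd H]].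
(* The cut at [/ 2] keeps [1 - delta] positive, so that it can serve as a contraction factor. *)
exists (Rmin d (/ 2)).
assert (Hm : 0 < Rmin d (/ 2) <= d /\ Rmin d (/ 2) <= / 2).
{ split; [split|]; [apply Rmin_glb_lt; lra|apply Rmin_l|apply Rmin_r]. }
split; [lra|].
intros r x y Hr Hx Hy Hxy.
destruct (Rlt_le_dec (N (vsub x y)) (eps * r)) as [|Hge]; [assumption|exfalso].
assert (Hi : 0 < / r) by now apply Rinv_0_lt_compat.
assert (Hir : / r * r = 1) by (apply Rinv_l; lra).
assert (Hs : forall z, N (vscal (/ r) z) = / r * N z).
{ intros z. rewrite N_scal, Rabs_right; lra. }
assert (Hd' := H (vscal (/ r) x) (vscal (/ r) y)).
rewrite <- vscal_sub, <- vscal_addr, (N_scal (/ 2)), (Rabs_right (/ 2)), !Hs in Hd' by lra.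
assert (Hle : / 2 * (/ r * N (vadd x y)) <= 1 - d).
{ apply Hd'.
  - rewrite <- Hir. apply Rmult_le_compat_l; lra.
  - rewrite <- Hir. apply Rmult_le_compat_l; lra.
  - apply Rle_ge. replace eps with (/ r * (eps * r)).
    + apply Rmult_le_compat_l; lra.
    + rewrite (Rmult_comm eps), <- Rmult_assoc, Hir. ring. }
assert (Hlt : / r * (2 * (r * (1 - Rmin d (/ 2)))) < / r * N (vadd x y)).
{ apply Rmult_lt_compat_l; lra. }
replace (/ r * (2 * (r * (1 - Rmin d (/ 2)))))
  with (2 * (1 - Rmin d (/ 2)) * (/ r * r)) in Hlt by ring.
rewrite Hir in Hlt. lra.
Qed.

(** One step of the new tree is two steps of the old one: [b] is kept, so both branches survive at
    each fork, and [e] chooses the second step. *)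
Fixpoint follow (e : list bool -> bool -> bool) (w : list bool) : list bool :=
  match w with
  | [] => []
  | b :: w' => e (follow e w') b :: b :: follow e w'
  end.

(** Branches that part at [w] still part at [follow e w]; the extra [1] is the step chosen by [e]
    right after [b]. *)
Lemma follow_app e u b w : exists v,
  follow e (u ++ b :: w) = v ++ b :: follow e w /\ length v = (2 * length u + 1)%nat.
Proof.
induction u as [|a u [v [Hv Hl]]]; simpl.
- now exists [e (follow e w) b].
- rewrite Hv. exists (e (v ++ b :: follow e w) a :: a :: v).
  split; [reflexivity|simpl; lia].
Qed.

(** Pass to selected two-step branches and halve the map. The lower bound survives because
    [(c / 2) * ((2 n + 1) + 1) = c * (n + 1)]. Since [q] depends only on [c] and [C0], the step can
    be iterated. *)
Lemma tree_bounds_improve c C0 : 0 < c -> 0 < C0 -> exists q, 0 < q < 1 /\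
  forall C F, C <= C0 -> tree_bounds c C F -> exists F', tree_bounds c (C * q) F'.
Proof.
intros Hc HC0.
destruct (Rle_lt_dec c (2 * C0)) as [HcC|HcC].
(* Here no [F] satisfies the bounds, so any [q] will do. *)
2: { exists (/ 2). split; [lra|].
     intros C F HC HF. apply tree_bounds_le in HF. lra. }
set (eps := c / (2 * C0)).
assert (He : eps * C0 = c / 2) by (unfold eps; field; lra).
assert (He0 : 0 < eps) by (unfold eps; apply Rdiv_lt_0_compat; lra).
destruct (uniformly_convex_scaled eps) as [d [Hd Huc]].
{ split; [assumption|]. nra. }
exists (1 - d). split; [lra|].
intros C F HC HF.
assert (HCp : 0 < C) by (apply tree_bounds_le in HF; lra).
destruct HF as [HFC HFc].
(* If both grandchildren were far from [F w], both second steps would be within [eps * C] of the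
   first step. The grandchildren would then be less than [2 * eps * C <= c] apart, against the fork
   bound. *)
assert (fork : forall w b, exists e,
  N (vsub (F (e :: b :: w)) (F w)) <= 2 * (C * (1 - d))).
{ intros w b.
  destruct (Rle_lt_dec (N (vsub (F (true :: b :: w)) (F w))) (2 * (C * (1 - d)))) as [|Ht];
    [now exists true|].
  destruct (Rle_lt_dec (N (vsub (F (false :: b :: w)) (F w))) (2 * (C * (1 - d)))) as [|Hf];
    [now exists false|exfalso].
  rewrite <- (vsub_chain _ (F (b :: w))) in Ht.
  rewrite <- (vsub_chain _ (F (b :: w))) in Hf.
  apply Huc in Ht; auto. apply Huc in Hf; auto.
  pose proof (HFc (b :: w) [] [] eq_refl) as H; simpl in H.
  rewrite <- (vsub_sub_common _ _ (F (b :: w))) in H.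
  pose proof (N_sub_triangle (vsub (F (true :: b :: w)) (F (b :: w)))
    (vsub (F (b :: w)) (F w)) (vsub (F (false :: b :: w)) (F (b :: w)))) as T.
  rewrite (N_sub_sym (vsub (F (b :: w)) (F w))) in T.
  assert (eps * C <= eps * C0) by (apply Rmult_le_compat_l; lra).
  lra. }
assert (He' : exists e, forall w b,
  N (vsub (F (e w b :: b :: w)) (F w)) <= 2 * (C * (1 - d))).
{ exists (fun w b => proj1_sig (constructive_indefinite_description _ (fork w b))).
  intros w b. exact (proj2_sig (constructive_indefinite_description _ (fork w b))). }
destruct He' as [e He'].
exists (fun w => vscal (/ 2) (F (follow e w))).
split.
- intros w b. rewrite <- vscal_sub, N_scal, Rabs_right by lra. simpl.
  specialize (He' (follow e w) b). lra.
- intros w u u' Hu. rewrite <- vscal_sub, N_scal, Rabs_right by lra.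
  destruct (follow_app e u true w) as [v [-> Hv]].
  destruct (follow_app e u' false w) as [v' [-> Hv']].
  assert (Hvv : length v = length v') by lia.
  pose proof (HFc (follow e w) v v' Hvv) as H.
  rewrite Hv, plus_INR, mult_INR in H. simpl in H. lra.
Qed.

(** Iteration sends the upper constant [C * q ^ k] to 0, while it must stay at least [c / 2]. *)
Lemma no_tree_in_uniformly_convex c C F : 0 < c -> ~ tree_bounds c C F.
Proof.
intros Hc HF.
assert (HC : 0 < C) by (apply tree_bounds_le in HF; lra).
destruct (tree_bounds_improve c C Hc HC) as [q [Hq Himp]].
assert (Hk : forall k, exists F', tree_bounds c (C * q ^ k) F').
{ induction k as [|k [F' HF']].
  - exists F. simpl. now rewrite Rmult_1_r.
  - simpl. rewrite (Rmult_comm q), <- Rmult_assoc. apply (Himp _ F'); [|assumption].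
    assert (q ^ k <= 1).
    { rewrite <- (pow1 k). apply pow_incr; lra. }
    nra. }
destruct (pow_lt_1_zero q) with (y := c / (2 * C)) as [k Hqk].
- rewrite Rabs_right; lra.
- apply Rdiv_lt_0_compat; lra.
- destruct (Hk k) as [F' HF']. apply tree_bounds_le in HF'.
  specialize (Hqk k (le_n k)).
  assert (0 < q ^ k) by (apply pow_lt; lra).
  rewrite Rabs_right in Hqk by lra.
  assert (2 * C * (c / (2 * C)) = c) by (field; lra).
  nra.
Qed.

End TreesInNormedSpaces.

(** * Groups and word metrics *)

Section GroupFacts.
Context {G : Group}.
Implicit Types g h : G.

Lemma gmul_Vr g : gmul g (ginv g) = gone.
Proof.
rewrite <- (gmul_1l _ (gmul g (ginv g))).
rewrite <- (gmul_Vl _ (ginv g)) at 1.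
rewrite <- gmul_assoc, (gmul_assoc _ (ginv g) g), gmul_Vl, gmul_1l.
apply gmul_Vl.
Qed.

Lemma gmul_1r g : gmul g gone = g.
Proof. now rewrite <- (gmul_Vl _ g), gmul_assoc, gmul_Vr, gmul_1l. Qed.

Lemma gmul_Kl g h : gmul (ginv g) (gmul g h) = h.
Proof. now rewrite gmul_assoc, gmul_Vl, gmul_1l. Qed.

Lemma gmul_KVl g h : gmul g (gmul (ginv g) h) = h.
Proof. now rewrite gmul_assoc, gmul_Vr, gmul_1l. Qed.

Lemma ginv_unique g h : gmul g h = gone -> ginv g = h.
Proof. intros H. now rewrite <- (gmul_Kl g h), H, gmul_1r. Qed.

Lemma ginv_inv g : ginv (ginv g) = g.
Proof. apply ginv_unique, gmul_Vl. Qed.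

Lemma ginv_1 : ginv gone = gone :> G.
Proof. apply ginv_unique, gmul_1l. Qed.

Lemma ginv_mul g h : ginv (gmul g h) = gmul (ginv h) (ginv g).
Proof. apply ginv_unique. now rewrite <- gmul_assoc, gmul_KVl, gmul_Vr. Qed.

Fixpoint gpow g (n : nat) : G :=
  match n with O => gone | S n' => gmul g (gpow g n') end.

Lemma gpow_comm g n : gmul g (gpow g n) = gmul (gpow g n) g.
Proof.
induction n as [|n IH]; simpl; [now rewrite gmul_1l, gmul_1r|].
now rewrite IH at 1; rewrite gmul_assoc.
Qed.

Lemma ginv_gpow g n : ginv (gpow g n) = gpow (ginv g) n.
Proof.
induction n as [|n IH]; simpl; [apply ginv_1|].
now rewrite gpow_comm, ginv_mul, IH.
Qed.

(* One of the two factors is always [1]. *)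
Definition gzpow g (k : Z) : G :=
  gmul (gpow g (Z.to_nat k)) (gpow (ginv g) (Z.to_nat (- k))).

Lemma gzpow_succ g k : gzpow g (Z.succ k) = gmul g (gzpow g k).
Proof.
unfold gzpow. destruct (Z_le_gt_dec 0 k) as [Hk|Hk].
- replace (Z.to_nat (Z.succ k)) with (S (Z.to_nat k)) by lia.
  replace (Z.to_nat (- Z.succ k)) with O by lia.
  replace (Z.to_nat (- k)) with O by lia.
  simpl. now rewrite !gmul_1r.
- replace (Z.to_nat (Z.succ k)) with O by lia.
  replace (Z.to_nat k) with O by lia.
  replace (Z.to_nat (- k)) with (S (Z.to_nat (- Z.succ k))) by lia.
  simpl. now rewrite !gmul_1l, gmul_KVl.
Qed.

Lemma gzpow_pred g k : gzpow g (Z.pred k) = gmul (ginv g) (gzpow g k).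
Proof. now rewrite <- (Z.succ_pred k) at 2; rewrite gzpow_succ, gmul_Kl. Qed.

Lemma gzpow_0 g : gzpow g 0 = gone.
Proof. apply gmul_1l. Qed.

Lemma gzpow_add g k l : gzpow g (k + l) = gmul (gzpow g k) (gzpow g l).
Proof.
induction k as [|k IH|k IH] using Z.peano_ind.
- now rewrite gzpow_0, gmul_1l.
- now rewrite Z.add_succ_l, !gzpow_succ, IH, gmul_assoc.
- now rewrite Z.add_pred_l, !gzpow_pred, IH, gmul_assoc.
Qed.

Lemma gzpow_opp g k : gzpow g (- k) = ginv (gzpow g k).
Proof.
symmetry. apply ginv_unique. now rewrite <- gzpow_add, Z.add_opp_diag_r, gzpow_0.
Qed.

Lemma gzpow_of_nat g n : gzpow g (Z.of_nat n) = gpow g n.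
Proof.
unfold gzpow. rewrite Nat2Z.id. replace (Z.to_nat (- Z.of_nat n)) with O by lia.
apply gmul_1r.
Qed.

Lemma gzpow_inj g : (forall n, gpow g (S n) <> gone) ->
  forall k l, gzpow g k = gzpow g l -> k = l.
Proof.
intros Hg.
assert (Hlt : forall k l, (k < l)%Z -> gzpow g k <> gzpow g l).
{ intros k l Hkl E.
  apply (Hg (Z.to_nat (l - k - 1))). rewrite <- gzpow_of_nat.
  replace (Z.of_nat (S (Z.to_nat (l - k - 1)))) with (l + - k)%Z by lia.
  now rewrite gzpow_add, gzpow_opp, <- E, gmul_Vr. }
intros k l E. destruct (Z.lt_trichotomy k l) as [H|[H|H]]; [|assumption|].
- now destruct (Hlt _ _ H).
- now destruct (Hlt _ _ H).
Qed.

Lemma word_eval_app (u v : list (bool * G)) :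
  word_eval (u ++ v) = gmul (word_eval u) (word_eval v).
Proof.
induction u as [|a u IH]; simpl; [now rewrite gmul_1l|].
unfold word_eval in *; simpl. now rewrite IH, gmul_assoc.
Qed.

Definition flip_letter (l : bool * G) : bool * G := (negb (fst l), snd l).

Lemma word_eval_inv (w : list (bool * G)) :
  word_eval (map flip_letter (rev w)) = ginv (word_eval w).
Proof.
induction w as [|a w IH]; simpl; [now rewrite ginv_1|].
rewrite map_app, word_eval_app, IH; simpl.
change (word_eval (a :: w)) with (gmul (letter_val a) (word_eval w)).
rewrite ginv_mul. f_equal.
unfold word_eval; simpl. rewrite gmul_1r.
destruct a as [[|] a]; unfold letter_val; simpl; [reflexivity|now rewrite ginv_inv].
Qed.

End GroupFacts.

(** * Word length, finite balls and Gromov products *)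

Section WordMetric.
Context {G : Group} (A : list G) (HS : generates A).
Implicit Types g h x y z : G.

(** A shortest word exists because [A] generates, so the [epsilon] in [word_length] never falls back
    on an arbitrary value. *)
Lemma word_length_spec g : is_word_length A g (word_length A g).
Proof.
unfold word_length. apply (epsilon_spec _ (fun n => is_word_length A g n)).
destruct (HS g) as [w0 [Hw0 E0]].
assert (H : forall n w, (length w <= n)%nat -> word_over A w -> word_eval w = g ->
  exists m, is_word_length A g m).
{ induction n as [|n IH]; intros w Hn Hw E.
  - exists 0%nat. split; [exists w; repeat split; auto; lia|intros; lia].
  - destruct (excluded_middle_informative
      (exists w', word_over A w' /\ word_eval w' = g /\ (length w' < length w)%nat))
      as [[w' [Hw' [E' L']]]|Hno].
    + apply (IH w'); auto; lia.
    + exists (length w). split; [exists w; auto|].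
      intros w' Hw' E'. apply Nat.nlt_ge. intros L. apply Hno. now exists w'. }
exact (H (length w0) w0 (le_n _) Hw0 E0).
Qed.

Lemma word_length_le_word w : word_over A w -> (word_length A (word_eval w) <= length w)%nat.
Proof. intros Hw. now apply (proj2 (word_length_spec (word_eval w))). Qed.

Lemma word_length_1 : word_length A gone = 0%nat.
Proof.
assert (H := word_length_le_word []). simpl in H.
apply Nat.le_0_r, H. intros l [].
Qed.

Lemma word_over_app (u v : list (bool * G)) :
  word_over A (u ++ v) <-> word_over A u /\ word_over A v.
Proof.
split.
- intros H; split; intros l Hl; apply H, in_or_app; auto.
- intros [Hu Hv] l Hl. apply in_app_or in Hl. destruct Hl; auto.
Qed.

Lemma word_length_mul g h :
  (word_length A (gmul g h) <= word_length A g + word_length A h)%nat.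
Proof.
destruct (proj1 (word_length_spec g)) as [u [Hu [Eu Lu]]].
destruct (proj1 (word_length_spec h)) as [v [Hv [Ev Lv]]].
rewrite <- Lu, <- Lv, <- length_app, <- Eu, <- Ev, <- word_eval_app.
now apply word_length_le_word, word_over_app.
Qed.

Lemma word_length_inv_le g : (word_length A (ginv g) <= word_length A g)%nat.
Proof.
destruct (proj1 (word_length_spec g)) as [u [Hu [Eu Lu]]].
rewrite <- Lu, <- Eu, <- word_eval_inv.
rewrite <- (length_rev u), <- (length_map flip_letter).
apply word_length_le_word. intros l Hl.
apply in_map_iff in Hl. destruct Hl as [l' [<- Hl']].
exact (Hu l' (proj2 (in_rev u l') Hl')).
Qed.

Lemma word_length_inv g : word_length A (ginv g) = word_length A g.
Proof.
apply Nat.le_antisymm; [apply word_length_inv_le|].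
rewrite <- (ginv_inv g) at 1. apply word_length_inv_le.
Qed.

Lemma ball_finite n : exists l : list G, forall g, (word_length A g <= n)%nat -> In g l.
Proof.
induction n as [|n [l Hl]].
- exists [gone]. intros g Hg. left.
  destruct (proj1 (word_length_spec g)) as [[|a u] [_ [E L]]]; [exact E|].
  simpl in L. lia.
- exists (gone :: map (fun p => gmul (fst p) (snd p)) (list_prod (A ++ map ginv A) l)).
  intros g Hg.
  destruct (proj1 (word_length_spec g)) as [[|a u] [Hu [E L]]]; [now left|right].
  apply in_map_iff. exists (letter_val a, word_eval u). split; [exact E|].
  apply in_prod.
  + assert (Ha : In (snd a) A) by (apply Hu; now left).
    apply in_or_app. unfold letter_val. destruct (fst a); [now left|right].
    now apply in_map.
  + apply Hl. simpl in L.
    assert (word_length A (word_eval u) <= length u)%nat; [|lia].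
    apply word_length_le_word. intros b Hb. apply Hu. now right.
Qed.

(* The two elements are the ends of a geodesic of length [2 n] translated so
   that its midpoint is [1]. *)
Lemma opposite_directions : infinite_group G -> forall n, exists x y,
  word_length A x = n /\ word_length A y = n /\
  word_length A (gmul (ginv x) y) = (2 * n)%nat.
Proof.
intros Hinf n.
assert (Hlong : exists g, (2 * n <= word_length A g)%nat).
{ destruct (excluded_middle_informative (exists g, (2 * n <= word_length A g)%nat))
    as [|Hno]; [assumption|exfalso].
  apply Hinf. destruct (ball_finite (2 * n)) as [l Hl]. exists l.
  intros g. apply Hl. destruct (Nat.le_gt_cases (word_length A g) (2 * n)); [assumption|].
  exfalso. apply Hno. exists g. lia. }
destruct Hlong as [g Hg].
destruct (proj1 (word_length_spec g)) as [u [Hu [E L]]].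
set (u1 := firstn n u). set (u2 := firstn n (skipn n u)). set (u3 := skipn n (skipn n u)).
assert (Eu : u = u1 ++ u2 ++ u3) by (unfold u1, u2, u3; now rewrite !firstn_skipn).
assert (L1 : length u1 = n) by (unfold u1; rewrite length_firstn; lia).
assert (L2 : length u2 = n) by (unfold u2; rewrite length_firstn, length_skipn; lia).
assert (L3 : length u = (length u1 + length u2 + length u3)%nat)
  by (rewrite Eu, !length_app; lia).
rewrite Eu in Hu. apply word_over_app in Hu. destruct Hu as [H1 H23].
apply word_over_app in H23. destruct H23 as [H2 H3].
exists (ginv (word_eval u1)), (word_eval u2).
rewrite word_length_inv, ginv_inv.
assert (E' : g = gmul (gmul (word_eval u1) (word_eval u2)) (word_eval u3))
  by (now rewrite <- E, Eu, !word_eval_app, gmul_assoc).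
(* As [u] is a shortest word, subadditivity must be an equality at each cut. *)
pose proof (word_length_mul (gmul (word_eval u1) (word_eval u2)) (word_eval u3)) as T3.
pose proof (word_length_mul (word_eval u1) (word_eval u2)) as T2.
rewrite <- E' in T3.
apply word_length_le_word in H1, H2, H3. lia.
Qed.

Notation d := (word_dist A).
Notation gp := (gromov_prod A).

Lemma word_dist_left g x y : d (gmul g x) (gmul g y) = d x y.
Proof. unfold word_dist. now rewrite ginv_mul, <- gmul_assoc, gmul_Kl. Qed.

Lemma word_dist_1l g : d gone g = INR (word_length A g).
Proof. unfold word_dist. now rewrite ginv_1, gmul_1l. Qed.

Lemma word_dist_refl x : d x x = 0.
Proof. unfold word_dist. now rewrite gmul_Vl, word_length_1. Qed.

Lemma word_dist_sym x y : d x y = d y x.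
Proof.
unfold word_dist. now rewrite <- word_length_inv, ginv_mul, ginv_inv.
Qed.

Lemma word_dist_mulr x y : d x (gmul x y) = d gone y.
Proof. now rewrite <- (gmul_1r x) at 1; rewrite word_dist_left. Qed.

Lemma word_dist_inv1 x : d gone (ginv x) = d gone x.
Proof. now rewrite !word_dist_1l, word_length_inv. Qed.

Lemma gromov_prod_left g x y w : gp (gmul g x) (gmul g y) (gmul g w) = gp x y w.
Proof. unfold gromov_prod. now rewrite !word_dist_left. Qed.

Lemma gromov_prod_sym x y w : gp x y w = gp y x w.
Proof. unfold gromov_prod. rewrite (word_dist_sym x y). lra. Qed.

(** In a triangle, the products at the two ends of a side share out its length. A small product at
    one end thus means a large one at the other. *)
Lemma gromov_prod_swap x y w : gp x y w + gp x w y = d w y.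
Proof.
unfold gromov_prod. rewrite (word_dist_sym w y). lra.
Qed.

Lemma gromov_prod_base_l x y : gp x y x = 0.
Proof.
unfold gromov_prod. rewrite word_dist_refl, (word_dist_sym y x). lra.
Qed.

Lemma word_dist_gromov_prod x y w : d x y = d w x + d w y - 2 * gp x y w.
Proof.
unfold gromov_prod. rewrite (word_dist_sym w x), (word_dist_sym w y). lra.
Qed.

(** * Broken geodesics in hyperbolic groups *)

Context (delta : R) (Hdelta : 0 <= delta).
Context (Hhyp : forall x y z w, gp x z w >= Rmin (gp x y w) (gp y z w) - delta).

(** The minimum in the hyperbolicity inequality is one of the two products. All later choices
    between directions use this dichotomy. *)
Lemma gromov_prod_small_one_side x y z w K : gp x z w <= K ->
  gp x y w <= K + delta \/ gp y z w <= K + delta.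
Proof.
intros H. pose proof (Hhyp x y z w) as T. unfold Rmin in T.
destruct (Rle_dec (gp x y w) (gp y z w)); [left|right]; lra.
Qed.

(** At [q], the product of [p0] and [p] is at least [d p q - K - delta], too large for the first
    alternative of the dichotomy. The bound [K + delta] is reproduced without loss, so it serves as
    an induction invariant. *)
Lemma broken_geodesic_step K p0 p q r :
  gp p0 q p <= K + delta -> gp p r q <= K -> 2 * K + 2 * delta < d p q ->
  gp p0 r q <= K + delta /\ d p0 q + d q r - 2 * (K + delta) <= d p0 r.
Proof.
intros H0 H1 Hl.
assert (H : gp p0 r q <= K + delta).
{ destruct (gromov_prod_small_one_side p p0 r q K H1) as [H|H]; [exfalso|exact H].
  pose proof (gromov_prod_swap p0 q p).
  rewrite (gromov_prod_sym p p0) in H. lra. }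
split; [exact H|].
rewrite (word_dist_gromov_prod p0 r q), (word_dist_sym q p0). lra.
Qed.

(** The powers of [h] form a broken geodesic with corners bounded by [K]; each segment gains at
    least [d gone h - 2 * (K + delta) >= 1]. *)
Lemma loxodromic_gpow K h : 0 <= K ->
  gp (ginv h) h gone <= K -> 2 * K + 2 * delta + 1 <= d gone h ->
  forall m, gp gone (gpow h (S m)) (gpow h m) <= K + delta /\
            INR m <= d gone (gpow h m).
Proof.
intros HK Hc Hl m.
assert (Hseg : forall k, d (gpow h k) (gpow h (S k)) = d gone h).
{ intros k. simpl. now rewrite gpow_comm, word_dist_mulr. }
induction m as [|m [IH1 IH2]].
- simpl. rewrite gromov_prod_base_l, word_dist_refl. lra.
- destruct (broken_geodesic_step K gone (gpow h m) (gpow h (S m))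
    (gpow h (S (S m)))) as [H1 H2].
  + exact IH1.
  + replace (gpow h m) with (gmul (gpow h (S m)) (ginv h)).
    2: { simpl. now rewrite gpow_comm, <- gmul_assoc, gmul_Vr, gmul_1r. }
    replace (gpow h (S (S m))) with (gmul (gpow h (S m)) h)
      by (symmetry; apply gpow_comm).
    rewrite <- (gmul_1r (gpow h (S m))) at 3.
    now rewrite gromov_prod_left.
  + rewrite Hseg. lra.
  + split; [exact H1|].
    rewrite S_INR.
    rewrite (word_dist_gromov_prod gone _ (gpow h m)), Hseg, (word_dist_sym _ gone). lra.
Qed.

(** The corner at [gpow h m], translated back to [1]. *)
Lemma loxodromic_backward K h m : 0 <= K ->
  gp (ginv h) h gone <= K -> 2 * K + 2 * delta + 1 <= d gone h ->
  gp (gpow (ginv h) m) h gone <= K + delta.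
Proof.
intros HK Hc Hl.
pose proof (proj1 (loxodromic_gpow K h HK Hc Hl m)) as H.
rewrite <- (gromov_prod_left (ginv (gpow h m))), gmul_1r, gmul_Vl in H.
now rewrite ginv_gpow in H; simpl in H; rewrite gpow_comm, <- ginv_gpow, gmul_Kl, ginv_gpow in H.
Qed.

(** * Triples of directions and virtually cyclic groups *)

(** A finite-scale substitute for three distinct points of the Gromov boundary. *)
Definition triple_at K D x y z : Prop :=
  (D <= d gone x /\ D <= d gone y /\ D <= d gone z) /\
  gp x y gone <= K /\ gp y z gone <= K /\ gp x z gone <= K.

Lemma exists_loxodromic : infinite_group G -> forall M, exists h,
  gp (ginv h) h gone <= 2 * delta + 1 /\ M <= d gone h.
Proof.
intros Hinf M.
destruct (INR_unbounded (Rabs M + 10 * delta + 10)) as [n Hn].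
pose proof (Rle_abs M). pose proof (Rabs_pos M).
destruct (opposite_directions Hinf n) as [x [y [Lx [Ly Lxy]]]].
assert (Dx : d gone x = INR n) by (now rewrite word_dist_1l, Lx).
assert (Dy : d gone y = INR n) by (now rewrite word_dist_1l, Ly).
assert (Pxy : gp x y gone <= 0).
{ unfold gromov_prod. rewrite (word_dist_sym x gone), (word_dist_sym y gone), Dx, Dy.
  unfold word_dist. rewrite Lxy, mult_INR. simpl. lra. }
destruct (Rle_lt_dec (gp (ginv x) x gone) (2 * delta + 1)) as [Hx|Hx].
{ exists x. split; lra. }
destruct (Rle_lt_dec (gp (ginv y) y gone) (2 * delta + 1)) as [Hy|Hy].
{ exists y. split; lra. }
(* Both [x], [ginv x] and [y], [ginv y] point the same way, while [x] and [y] are opposite; hence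
   the inverses diverge and [x y^-1] has little cancellation. *)
assert (P : gp (ginv x) (ginv y) gone <= 2 * delta).
{ destruct (gromov_prod_small_one_side x (ginv x) y gone 0 Pxy) as [T|T].
  - rewrite gromov_prod_sym in T. lra.
  - destruct (gromov_prod_small_one_side (ginv x) (ginv y) y gone _ T); lra. }
set (h := gmul x (ginv y)).
assert (Eh : ginv h = gmul y (ginv x)) by (unfold h; now rewrite ginv_mul, ginv_inv).
assert (Qx : gp gone h x = gp (ginv x) (ginv y) gone).
{ rewrite <- (gromov_prod_left (ginv x)). unfold h. now rewrite gmul_1r, gmul_Kl, gmul_Vl. }
assert (Qy : gp gone (ginv h) y = gp (ginv x) (ginv y) gone).
{ rewrite <- (gromov_prod_left (ginv y)), Eh, gmul_1r, gmul_Kl, gmul_Vl.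
  apply gromov_prod_sym. }
exists h. split.
- pose proof (gromov_prod_swap h gone x) as Sx. rewrite (gromov_prod_sym h gone) in Sx.
  pose proof (gromov_prod_swap (ginv h) gone y) as Sy.
  rewrite (gromov_prod_sym (ginv h) gone) in Sy.
  rewrite (word_dist_sym x gone) in Sx. rewrite (word_dist_sym y gone) in Sy.
  rewrite gromov_prod_sym.
  (* The large products of [h] with [x] and of [ginv h] with [y] transfer the divergence of [x] and
     [y] to [h] and [ginv h]. *)
  destruct (gromov_prod_small_one_side x h y gone 0 Pxy) as [T|T].
  + rewrite gromov_prod_sym in T. lra.
  + destruct (gromov_prod_small_one_side h (ginv h) y gone _ T); lra.
- rewrite (word_dist_gromov_prod gone h x), Qx, (word_dist_sym x gone), Dx.
  unfold h. rewrite word_dist_mulr, word_dist_inv1, Dy. lra.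
Qed.

(** The distance hypotheses bound the products of [g] with [h] and [ginv h] by half of [d gone h].
    Powers of [h] follow [h] for longer than that, so they too diverge from [g]. The bound
    [d gone h] is independent of [g] and [m]. *)
Lemma far_from_loxodromic_gives_triple K h g m D : 0 <= K ->
  gp (ginv h) h gone <= K -> 2 * K + 4 * delta + 1 <= d gone h ->
  d gone g <= d h g -> d gone g <= d (ginv h) g ->
  D <= INR m -> D <= d gone g ->
  triple_at (d gone h) D g (gpow h m) (gpow (ginv h) m).
Proof.
intros HK Hc Hl Hg1 Hg2 Hm Hg.
assert (Hc' : gp (ginv (ginv h)) (ginv h) gone <= K)
  by (now rewrite ginv_inv, gromov_prod_sym).
assert (Hl' : 2 * K + 4 * delta + 1 <= d gone (ginv h)) by (now rewrite word_dist_inv1).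
(* The case [m = O] is apart: [gpow k 0] is [1] and has no direction. *)
assert (main : forall k, gp (ginv k) k gone <= K -> 2 * K + 4 * delta + 1 <= d gone k ->
  d gone k - K - delta <= gp k (gpow k m) gone \/ m = O).
{ intros k Hk Lk. destruct m as [|n]; [now right|left].
  pose proof (loxodromic_backward K (ginv k) n HK) as B.
  rewrite ginv_inv, word_dist_inv1 in B.
  assert (T : gp (gpow k n) (ginv k) gone <= K + delta).
  { apply B; [now rewrite gromov_prod_sym|lra]. }
  rewrite <- (gromov_prod_left k), gmul_1r, gmul_Vr in T.
  change (gmul k (gpow k n)) with (gpow k (S n)) in T.
  pose proof (gromov_prod_swap (gpow k (S n)) gone k) as E.
  rewrite (word_dist_sym k gone) in E.
  rewrite (gromov_prod_sym k). lra. }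
assert (Z0 : forall x, gp gone x gone = 0).
{ intros x. apply gromov_prod_base_l. }
assert (side : forall k, gp (ginv k) k gone <= K -> 2 * K + 4 * delta + 1 <= d gone k ->
  d gone g <= d k g -> gp g (gpow k m) gone <= d gone k).
{ intros k Hk Lk Gk.
  destruct (main k Hk Lk) as [T| ->].
  2: { simpl. rewrite gromov_prod_sym, Z0. lra. }
  assert (gp g k gone <= d gone k / 2).
  { unfold gromov_prod.
    rewrite (word_dist_sym g gone), (word_dist_sym g k), (word_dist_sym k gone). lra. }
  destruct (gromov_prod_small_one_side g (gpow k m) k gone _ H) as [U|U].
  - lra.
  - rewrite gromov_prod_sym in U. lra. }
split; [split; [exact Hg|split]|split; [|split]].
- eapply Rle_trans; [exact Hm|]. apply (loxodromic_gpow K h HK Hc). lra.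
- eapply Rle_trans; [exact Hm|]. apply (loxodromic_gpow K (ginv h) HK Hc'). lra.
- now apply side.
- pose proof (loxodromic_backward K h m HK Hc) as B.
  destruct (main h Hc Hl) as [T| ->]; [|simpl; rewrite Z0; lra].
  assert (B' : gp (gpow (ginv h) m) h gone <= K + delta) by (apply B; lra).
  destruct (gromov_prod_small_one_side _ (gpow h m) _ _ _ B') as [U|U].
  + rewrite gromov_prod_sym. lra.
  + rewrite gromov_prod_sym in U. lra.
- rewrite <- word_dist_inv1. now apply side.
Qed.

Lemma virtually_Z_of_no_triple : infinite_group G ->
  (forall K, exists D, forall x y z, ~ triple_at K D x y z) -> virtually_Z G.
Proof.
intros Hinf Hno.
set (K := 2 * delta + 1).
destruct (exists_loxodromic Hinf (2 * K + 4 * delta + 1)) as [h [Hc Hl]].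
fold K in Hc.
assert (HK : 0 <= K) by (unfold K; lra).
destruct (Hno (d gone h)) as [D HD].
destruct (INR_unbounded D) as [m Hm].
(* Descent on length by powers of [h]. The length-zero alternative covers a nonpositive [D]. *)
assert (short : forall n g, (word_length A g <= n)%nat ->
  exists k, d gone (gmul (gzpow h k) g) < D \/ word_length A (gmul (gzpow h k) g) = 0%nat).
{ induction n as [|n IH]; intros g Hn.
  { exists 0%Z. right. rewrite gzpow_0, gmul_1l. lia. }
  destruct (Rlt_le_dec (d gone g) D) as [Hg|Hg].
  { exists 0%Z. left. now rewrite gzpow_0, gmul_1l. }
  assert (descend : forall k, d (gzpow h k) g < d gone g ->
    exists k', d gone (gmul (gzpow h k') g) < D \/
               word_length A (gmul (gzpow h k') g) = 0%nat).
  { intros k Hk. destruct (IH (gmul (gzpow h (- k)) g)) as [k' H'].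
    - rewrite word_dist_1l in Hk. unfold word_dist in Hk. apply INR_lt in Hk.
      rewrite gzpow_opp. lia.
    - exists (k' + - k)%Z. now rewrite gzpow_add, <- gmul_assoc. }
  destruct (Rlt_le_dec (d h g) (d gone g)) as [H1|H1].
  { apply (descend 1%Z). unfold gzpow; simpl. now rewrite !gmul_1r. }
  destruct (Rlt_le_dec (d (ginv h) g) (d gone g)) as [H2|H2].
  { apply (descend (-1)%Z). unfold gzpow; simpl. now rewrite gmul_1l, gmul_1r. }
  exfalso. apply (HD g (gpow h m) (gpow (ginv h) m)).
  apply (far_from_loxodromic_gives_triple K); auto. lra. }
exists (fun g => exists k, gzpow h k = g).
split; [|split].
- split; [|split].
  + exists 0%Z. apply gzpow_0.
  + intros a b [k <-] [l <-]. exists (k + l)%Z. apply gzpow_add.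
  + intros a [k <-]. exists (- k)%Z. apply gzpow_opp.
- destruct (ball_finite m) as [l Hlist]. exists l.
  (* Descent multiplies on the left while the cosets have [<h>] on the right, hence the inverse of
     [g]. *)
  intros g. destruct (short _ (ginv g) (le_n _)) as [k Hk].
  exists (ginv (gmul (gzpow h k) (ginv g))), (gzpow h k).
  split; [|split].
  + apply Hlist. rewrite word_length_inv. destruct Hk as [Hk| ->]; [|lia].
    rewrite word_dist_1l in Hk. apply INR_le. lra.
  + now exists k.
  + now rewrite ginv_mul, ginv_inv, <- gmul_assoc, gmul_Vl, gmul_1r.
- exists (gzpow h). split; [|split; [|split]].
  + apply gzpow_add.
  + apply gzpow_inj. intros n E.
    pose proof (proj2 (loxodromic_gpow K h HK Hc ltac:(lra) (S n))) as T.
    rewrite E, word_dist_refl in T.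
    pose proof (lt_0_INR (S n) ltac:(lia)). lra.
  + intros n. now exists n.
  + intros g Hg. exact Hg.
Qed.

(** * A tree spanned by a triple of directions *)

(** Of any two of the three directions, one diverges from [ginv s]; so at least two of the three do,
    and these become the branches after [s]. *)
Lemma branching_of_triple K D x y z : triple_at K D x y z ->
  exists (br : G -> bool -> G) (M : R), forall s,
    (forall b, gp (ginv s) (br s b) gone <= K + delta /\ D <= d gone (br s b) <= M) /\
    gp (br s true) (br s false) gone <= K + delta.
Proof.
intros [[Dx [Dy Dz]] [Pxy [Pyz Pxz]]].
set (M := d gone x + d gone y + d gone z).
assert (pos : forall g, 0 <= d gone g) by (intros g; apply pos_INR).
pose proof (pos x); pose proof (pos y); pose proof (pos z).
assert (H' : forall s, exists f : bool -> G,
  (forall b, gp (ginv s) (f b) gone <= K + delta /\ D <= d gone (f b) <= M) /\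
  gp (f true) (f false) gone <= K + delta).
{ intros s.
  assert (pick : forall u v, D <= d gone u <= M -> D <= d gone v <= M ->
    gp u v gone <= K -> gp (ginv s) u gone <= K + delta -> gp (ginv s) v gone <= K + delta ->
    exists f : bool -> G,
      (forall b, gp (ginv s) (f b) gone <= K + delta /\ D <= d gone (f b) <= M) /\
      gp (f true) (f false) gone <= K + delta).
  { intros u v Hu Hv Huv Hsu Hsv. exists (fun b : bool => if b then u else v).
    split; [intros [|]; auto|lra]. }
  destruct (gromov_prod_small_one_side x (ginv s) y gone K Pxy) as [P|P];
  destruct (gromov_prod_small_one_side y (ginv s) z gone K Pyz) as [B|B];
  destruct (gromov_prod_small_one_side x (ginv s) z gone K Pxz) as [C|C];
  rewrite 1?(gromov_prod_sym x (ginv s)) in P;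
  rewrite 1?(gromov_prod_sym y (ginv s)) in B;
  rewrite 1?(gromov_prod_sym x (ginv s)) in C;
  first [ apply (pick x y); unfold M in *; solve [auto|lra]
        | apply (pick y z); unfold M in *; solve [auto|lra]
        | apply (pick x z); unfold M in *; solve [auto|lra] ]. }
exists (fun s => proj1_sig (constructive_indefinite_description _ (H' s))), M.
intros s. exact (proj2_sig (constructive_indefinite_description _ (H' s))).
Qed.

Section Tree.
Context (br : G -> bool -> G) (K M : R) (HK : 0 <= K).
Context (Hbr : forall s,
  (forall b, gp (ginv s) (br s b) gone <= K /\
             2 * K + 2 * delta + 1 <= d gone (br s b) <= M) /\
  gp (br s true) (br s false) gone <= K).

(** Only the segment leading into a node constrains the branches there; the root uses the trivial
    segment. *)
Fixpoint last_segment (w : list bool) : G :=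
  match w with [] => gone | b :: w' => br (last_segment w') b end.

Fixpoint tree_node (w : list bool) : G :=
  match w with [] => gone | b :: w' => gmul (tree_node w') (last_segment (b :: w')) end.

Lemma tree_edge b w :
  2 * K + 2 * delta + 1 <= d (tree_node w) (tree_node (b :: w)) <= M.
Proof. simpl. rewrite word_dist_mulr. now apply Hbr. Qed.

Lemma tree_corner b b' w : gp (tree_node w) (tree_node (b' :: b :: w)) (tree_node (b :: w)) <= K.
Proof.
rewrite <- (gromov_prod_left (ginv (tree_node (b :: w)))), gmul_Vl.
change (tree_node (b' :: b :: w))
  with (gmul (tree_node (b :: w)) (br (last_segment (b :: w)) b')).
rewrite gmul_Kl.
replace (gmul (ginv (tree_node (b :: w))) (tree_node w)) with (ginv (last_segment (b :: w))).
- now apply Hbr.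
- simpl. now rewrite ginv_mul, <- gmul_assoc, gmul_Vl, gmul_1r.
Qed.

Lemma tree_fork w : gp (tree_node (true :: w)) (tree_node (false :: w)) (tree_node w) <= K.
Proof.
rewrite <- (gmul_1r (tree_node w)) at 1. simpl. rewrite gromov_prod_left. apply Hbr.
Qed.

(** Induction from the end of [u]: each further letter there is one more edge of the broken geodesic
    climbing to [w]. *)
Lemma tree_ascend u b w :
  gp (tree_node (u ++ b :: w)) (tree_node w) (tree_node (b :: w)) <= K + delta /\
  INR (length u) + 1 <= d (tree_node (u ++ b :: w)) (tree_node w).
Proof.
revert b w. induction u as [|b' u IH] using rev_ind; intros b w.
- change ([] ++ b :: w) with (b :: w).
  rewrite gromov_prod_base_l, word_dist_sym.
  pose proof (tree_edge b w). simpl length. simpl INR. lra.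
- rewrite <- app_assoc. change ([b'] ++ b :: w) with (b' :: b :: w).
  destruct (IH b' (b :: w)) as [I1 I2].
  pose proof (tree_edge b' (b :: w)) as E'. pose proof (tree_edge b w) as E.
  destruct (broken_geodesic_step K _ _ _ (tree_node w) I1) as [S1 S2].
  + rewrite gromov_prod_sym. apply tree_corner.
  + rewrite word_dist_sym. lra.
  + split; [exact S1|]. rewrite length_app, plus_INR. simpl length. simpl (INR 1).
    rewrite (word_dist_sym (tree_node (b :: w)) (tree_node w)) in S2. lra.
Qed.

(** The climbing path turns at the fork [w] and goes down the other side, never losing length. The
    extra child [b] lets the invariant speak of the next corner. *)
Lemma tree_descend u w u' b :
  gp (tree_node (u ++ true :: w)) (tree_node (b :: u' ++ false :: w))
     (tree_node (u' ++ false :: w)) <= K + delta /\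
  INR (length u) + 1 <= d (tree_node (u ++ true :: w)) (tree_node (u' ++ false :: w)).
Proof.
revert b. induction u' as [|b' u' IH]; intros b.
- change ([] ++ false :: w) with (false :: w).
  destruct (tree_ascend u true w) as [A1 A2].
  pose proof (tree_edge true w) as E. pose proof (tree_edge false w) as E'.
  destruct (broken_geodesic_step K _ _ _ (tree_node (false :: w)) A1) as [S1 S2].
  + apply tree_fork.
  + rewrite word_dist_sym. lra.
  + destruct (broken_geodesic_step K _ _ _ (tree_node (b :: false :: w)) S1) as [T1 T2].
    * apply tree_corner.
    * lra.
    * split; [exact T1|lra].
- destruct (IH b') as [I1 I2].
  change ((b' :: u') ++ false :: w) with (b' :: (u' ++ false :: w)).
  pose proof (tree_edge b' (u' ++ false :: w)) as E.
  destruct (broken_geodesic_step K _ _ _ (tree_node (b :: b' :: u' ++ false :: w)) I1)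
    as [S1 S2].
  + apply tree_corner.
  + lra.
  + split; [exact S1|].
    rewrite (word_dist_gromov_prod _ _ (tree_node (u' ++ false :: w))).
    rewrite (word_dist_sym _ (tree_node (u ++ true :: w))). lra.
Qed.

End Tree.

End WordMetric.

(** * Transfer of the tree from the group to the Banach space *)

Theorem theoremT (G : Group) (S : list G) (X : NormedSpace) :
  infinite_group G ->
  generates S ->
  word_hyperbolic S ->
  ~ virtually_Z G ->
  Banach X ->
  bilipschitz_embeds S X ->
  ~ superreflexive X.
Proof.
intros Hinf HS [delta [Hdelta Hhyp]] HnZ _ [f [c [C [Hc [HcC Hf]]]]]
  [N [[_ [N_scal [N_triangle [a [b [Ha [Hb Hab]]]]]]] N_uc]].
apply HnZ, (virtually_Z_of_no_triple S HS delta Hdelta Hhyp Hinf).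
intros K0.
destruct (excluded_middle_informative (exists D, forall x y z, ~ triple_at S K0 D x y z))
  as [|Hno]; [assumption|exfalso].
(* The tree needs a nonnegative constant, and choosing branches costs one [delta]. *)
set (K := Rmax K0 0 + delta).
assert (HK : 0 <= K) by (unfold K; pose proof (Rmax_r K0 0); lra).
assert (HKK : K0 + delta <= K) by (unfold K; pose proof (Rmax_l K0 0); lra).
assert (Ht : exists x y z, triple_at S K0 (2 * K + 2 * delta + 1) x y z).
{ destruct (excluded_middle_informative
    (exists x y z, triple_at S K0 (2 * K + 2 * delta + 1) x y z)) as [|H]; [assumption|].
  exfalso. apply Hno. exists (2 * K + 2 * delta + 1). intros x y z T.
  apply H. now exists x, y, z. }
destruct Ht as [x [y [z Ht]]].
destruct (branching_of_triple S HS delta Hdelta Hhyp K0 _ x y z Ht) as [br [M Hbr]].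
assert (Hbr' : forall s,
  (forall b, gromov_prod S (ginv s) (br s b) gone <= K /\
             2 * K + 2 * delta + 1 <= word_dist S gone (br s b) <= M) /\
  gromov_prod S (br s true) (br s false) gone <= K).
{ intros s. destruct (Hbr s) as [H1 H2]. split; [|lra].
  intros e. destruct (H1 e). split; [lra|assumption]. }
(* Edges have length at most [M]; [a] and [b] convert between the given norm and [N]. *)
apply (no_tree_in_uniformly_convex N N_scal N_triangle N_uc (a * c) (b * (C * M))
  (fun w => f (tree_node br w))).
{ now apply Rmult_lt_0_compat. }
split.
- intros w e. eapply Rle_trans; [apply Hab|].
  apply Rmult_le_compat_l; [lra|].
  eapply Rle_trans; [apply Hf|]. apply Rmult_le_compat_l; [lra|].
  rewrite (word_dist_sym S HS).
  apply (tree_edge S delta br K M Hbr' e w).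
- intros w u u' _. eapply Rle_trans; [|apply Hab].
  rewrite Rmult_assoc. apply Rmult_le_compat_l; [lra|].
  eapply Rle_trans; [|apply Hf]. apply Rmult_le_compat_l; [lra|].
  (* The child [true] is a dummy, as only the distance bound is used. *)
  apply (tree_descend S HS delta Hdelta Hhyp br K M HK Hbr' u w u' true).
Qed.
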